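(* Let $\Lambda\subseteq\mathbb{R}^d$ be a Meyer set, let $\curlywedge(W)$ be any fully Euclidean model set in a cut and project scheme $(\mathbb{R}^d,\mathbb{R}^m,\mathcal{L})$, and let $F\subseteq\mathbb{R}^d$ be finite such that $$\Lambda\subseteq\curlywedge(W)+F.$$ Then $$\operatorname{ap-rank}(\Lambda)=d+m=\operatorname{ap-rank}(\curlywedge(W))=\operatorname{rank}(\curlywedge(W)).$$ Moreover, for each $N\in\mathbb{N}$ there exists some $R>0$ such that, for all $y\in\mathbb{R}^d$, the set $\Lambda\cap B_R(y)$ contains an li-arithmetic progression of length $N$ and rank $d+m$.
   Context: Here $d\ge 1$, $m\ge 0$ are integers and $B_R(y)$ is the ball of radius $R$ centred at $y$. A set $\Lambda\subseteq\mathbb{R}^d$ is relatively dense if there is $R>0$ such that every ball $B_R(x)$, $x\in\mathbb{R}^d$, contains a point of $\Lambda$; it is uniformly discrete if there is $r>0$ such that every ball $B_r(x)$ contains at most one point of $\Lambda$. A Meyer set is a relatively dense set $\Lambda\subseteq\mathbb{R}^d$ such that $\Lambda-\Lambda$ is uniformly discrete. A fully Euclidean cut and project scheme (CPS) $(\mathbb{R}^d,\mathbb{R}^m,\mathcal{L})$ consists of $\mathbb{R}^d$, $\mathbb{R}^m$ and a lattice (discrete co-compact subgroup) $\mathcal{L}\subset\mathbb{R}^d\times\mathbb{R}^m$ such that the canonical projection to $\mathbb{R}^d$ is injective on $\mathcal{L}$ and the image of $\mathcal{L}$ under the canonical projection to $\mathbb{R}^m$ is dense in $\mathbb{R}^m$.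 For $W\subseteq\mathbb{R}^m$, $\curlywedge(W):=\{x\in\mathbb{R}^d : \exists\, y\in W \text{ with } (x,y)\in\mathcal{L}\}$. It is called a fully Euclidean model set when $W$ is precompact and has non-empty interior; such sets are Meyer sets. An li-arithmetic progression of length $N$ and rank $k$ is a set $\{s+c_1r_1+\dots+c_kr_k : c_j\in\mathbb{Z},\ 0\le c_j\le N\ \forall j\}$ with $s,r_1,\dots,r_k\in\mathbb{R}^d$ and $r_1,\dots,r_k$ linearly independent over $\mathbb{Z}$. For a Meyer set $\Lambda$, the group $\langle\Lambda\rangle$ generated by $\Lambda$ is a free $\mathbb{Z}$-module of finite rank, and $\operatorname{rank}(\Lambda):=\operatorname{rank}_{\mathbb{Z}}(\langle\Lambda\rangle)$. The number $\operatorname{ap-rank}(\Lambda)$ is the largest $k\in\mathbb{N}$ such that for all $N\in\mathbb{N}$ there exists an li-arithmetic progression of length $N$ and rank $k$ contained in $\Lambda$. *)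

(* Defs.v *)
From HB Require Import structures.
From mathcomp Require Import all_boot all_order all_algebra.
From mathcomp Require Import all_classical all_reals all_analysis.
Import Order.TTheory GRing.Theory Num.Theory numFieldNormedType.Exports.

Set Implicit Arguments.
Unset Strict Implicit.
Unset Printing Implicit Defensive.

Local Open Scope classical_set_scope.
Local Open Scope ring_scope.

(* Euclidean ball: the norm that the library puts on 'rV[R]_d is the sup norm,
   which induces the same topology but has different balls. *)
Definition eball (R : realType) (d : nat) (y : 'rV[R]_d) (r : R) :
    set 'rV[R]_d :=
  [set x | Num.sqrt (\sum_(i < d) (x 0 i - y 0 i) ^+ 2) < r].

Definition relatively_dense (R : realType) (d : nat) (A : set 'rV[R]_d) :=
  exists2 r : R, 0 < r & forall x, (eball x r `&` A) !=set0.

Definition uniformly_discrete (R : realType) (d : nat) (A : set 'rV[R]_d) :=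
  exists2 r : R, 0 < r & forall x, is_subset1 (eball x r `&` A).

Definition meyer (R : realType) (d : nat) (A : set 'rV[R]_d) :=
  relatively_dense A /\
  uniformly_discrete [set x - y | x in A & y in A].

Definition is_subgroup (V : zmodType) (H : set V) :=
  H 0 /\ forall x y, H x -> H y -> H (x - y).

Definition zgenerated (V : zmodType) (A : set V) : set V :=
  smallest (@is_subgroup V) A.

Definition zfree (V : zmodType) (k : nat) (b : 'I_k -> V) :=
  forall c : 'I_k -> int, \sum_(j < k) b j *~ c j = 0 -> forall j, c j = 0.

(* A has rank k: the group generated by A is a free Z-module having a basis of
   k elements. *)
Definition has_rank (V : zmodType) (A : set V) (k : nat) :=
  exists b : 'I_k -> V, zfree b /\
    zgenerated A = [set x | exists c : 'I_k -> int,
                              x = \sum_(j < k) b j *~ c j].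

Definition arith_prog (V : zmodType) (N k : nat) (s : V) (r : 'I_k -> V) :
    set V :=
  [set x | exists2 c : 'I_k -> int,
     (forall j, 0 <= c j <= N%:Z) & x = s + \sum_(j < k) r j *~ c j].

Definition li_arith_prog (V : zmodType) (N k : nat) (P : set V) :=
  exists (s : V) (r : 'I_k -> V), zfree r /\ P = arith_prog N s r.

Definition contains_li_ap (V : zmodType) (N k : nat) (A : set V) :=
  exists2 P : set V, li_arith_prog N k P & P `<=` A.

Definition has_ap_rank (V : zmodType) (A : set V) (k : nat) :=
  (forall N, contains_li_ap N k A) /\
  (forall k', (forall N, contains_li_ap N k' A) -> (k' <= k)%N).

Definition coset_rel (V : zmodType) (H : set V) : rel V :=
  fun x y => `[< H (x - y) >].

Lemma coset_rel_equiv (V : zmodType) (H : set V) :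
  is_subgroup H -> equiv_class_of (coset_rel H).
Proof.
move=> [H0 HB]; split=> [x|x y|y x z].
- by apply/asboolP; rewrite subrr.
- by apply/asboolP/asboolP => Hxy; have := HB _ _ H0 Hxy; rewrite sub0r opprB.
- move=> /asboolP Hxy /asboolP Hyz; apply/asboolP.
  have Hzy : H (z - y) by have := HB _ _ H0 Hyz; rewrite sub0r opprB.
  by have := HB _ _ Hxy Hzy; rewrite opprB subrKA.
Qed.

Definition coset_equiv (V : zmodType) (H : set V) (sH : is_subgroup H) :
    equiv_rel V :=
  EquivRelPack (coset_rel_equiv sH).

Definition coset_space (V : topologicalZmodType) (H : set V)
    (sH : is_subgroup H) : topologicalType :=
  quotient_topology {eq_quot (coset_equiv sH)}%qT.

Definition is_lattice (V : topologicalZmodType) (L : set V) :=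
  L `<=` isolated L /\
  exists sL : is_subgroup L, compact [set: coset_space sL].

Definition is_cps (R : realType) (d m : nat) (L : set ('rV[R]_d * 'rV[R]_m)) :=
  [/\ is_lattice L,
      set_inj L fst &
      dense (snd @` L)].

Definition cut_project (R : realType) (d m : nat)
    (L : set ('rV[R]_d * 'rV[R]_m)) (W : set 'rV[R]_m) : set 'rV[R]_d :=
  [set x | exists2 y, W y & L (x, y)].

Definition model_window (R : realType) (m : nat) (W : set 'rV[R]_m) :=
  precompact W /\ interior W !=set0.

(* Main.v *)
Require Import Defs.
From HB Require Import structures.
From mathcomp Require Import all_boot all_order all_algebra.
From mathcomp Require Import all_classical all_reals all_analysis.
From mathcomp Require Import ring lra.
Import Order.TTheory GRing.Theory Num.Theory numFieldNormedType.Exports.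
Set Implicit Arguments.
Unset Strict Implicit.
Unset Printing Implicit Defensive.
Local Open Scope classical_set_scope.
Local Open Scope ring_scope.

(** Write n = d + m.  The lattice L has a Z-basis of n vectors, so its image
    pi1(L) in R^d is a free group of rank n; everything is measured against
    this group.

    Upper bound.  If A is contained in a model set plus a finite set F, then
    along each direction r of a progression in A of length at least #|F| two
    points use the same translate f, so a nonzero multiple of r lies in pi1(L)
    ([ap_rank_le]).  Hence at most n of the directions are Z-independent.

    Lower bound.  L is already generated by its vectors with an arbitrarily
    small R^m-component, because pi2(L) is dense and any vector of L can be
    halved repeatedly up to small errors ([strip_generates]).  As L spans
    R^(d+m), these short vectors contain a basis of R^(d+m)
    ([short_star_basis]).  Using it as a set of directions, the model set of
    the unit ball contains progressions of rank n of any prescribed length,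
    starting within a bounded distance of any point.  Now let A be relatively
    dense and contained in a model set plus F.  A point x of the model set of
    the unit ball is close to some a in A, and x - a ranges over a finite set D
    since L is discrete ([cut_covered_by_translates]).  Colour x by such an
    element of D: by the theorem of Gallai ([gallai]) a long progression
    contains a monochromatic homothetic copy of the progression of length N,
    and subtracting its colour moves it into A
    ([relatively_dense_contains_li_ap]).

    The rank.  The differences of points of a model set contain all vectors of
    pi1(L) with a small R^m-component, so they generate pi1(L)
    ([has_rank_cut_project]). *)

(** * The theorem of Gallai *)

Lemma finite_pigeonhole (T : eqType) (X : seq T) (f : nat -> T) :
  (forall i, (i <= size X)%N -> f i \in X) ->
  exists i j, [/\ (i < j)%N, (j <= size X)%N & f i = f j].
Proof.
move=> fX; set s := mkseq f (size X).+1.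
have : ~~ uniq s.
  apply/negP => us; have := @uniq_leq_size _ s X us.
  rewrite size_mkseq => /(_ _) hs.
  suff: (size X < size X)%N by rewrite ltnn.
  apply: hs => x /mapP[i]; rewrite mem_iota => /= hi ->.
  exact: fX.
case/(uniqPn (f 0%N)) => i [j]; rewrite size_mkseq => -[ij js].
rewrite !nth_mkseq ?(ltn_trans ij js)// => eqf.
by exists i, j.
Qed.

Definition monochromatic (V : zmodType) (C : Type) (chi : V -> C) (A : seq V)
    (p : V * nat) :=
  (0 < p.2)%N /\
  {in A &, forall a b, chi (p.1 + a *+ p.2) = chi (p.1 + b *+ p.2)}.

(** The finite list P of candidate copies is chosen before the colouring; this
    uniformity is what later gives a radius that does not depend on the centre
    of the ball. *)
Definition partition_regular (V : zmodType) (A : seq V) :=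
  forall C : finType, exists P : seq (V * nat), forall chi : V -> C,
    exists2 p, p \in P & monochromatic chi A p.

Definition copies (V : zmodType) (A : seq V) (P : seq (V * nat)) : seq V :=
  [seq p.1 + a *+ p.2 | p <- P, a <- A].

Definition focused (V : zmodType) (C : Type) (chi : V -> C) (A : seq V)
    (e f : V) (c : C) (p : V * nat) :=
  [/\ (0 < p.2)%N, f = p.1 + e *+ p.2 &
      {in A, forall a, chi (p.1 + a *+ p.2) = c}].

(** Colour focusing.  Suppose that the pattern a0 :: A is known to be partition
    regular and e is a further point.  Either a copy of the enlarged pattern is
    monochromatic, or there are j copies of a0 :: A, each monochromatic, with j
    different colours, whose extensions by e all meet in the same point f.  To
    pass from j to j + 1, colour x by the restriction of chi to x + B, where B
    collects all points used for j.  A monochromatic copy s + q (a0 :: A) for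
    this colouring carries identical blocks x + B, and one combines the copies
    inside the blocks with the motion from block to block.  The colour of the
    focus of a block is either one of the j colours, which completes a copy of
    the enlarged pattern, or a new one. *)
Lemma focusing (V : zmodType) (a0 e : V) (A : seq V) (C : finType) (j : nat) :
  partition_regular (a0 :: A) ->
  exists P : seq (V * nat), forall chi : V -> C,
    (exists2 p, p \in P & monochromatic chi [:: e, a0 & A] p) \/
    exists2 f, f \in 0 :: copies [:: e, a0 & A] P &
      exists l : seq C, [/\ uniq l, size l = j &
        {in l, forall c, exists2 p, p \in P & focused chi (a0 :: A) e f c p}].
Proof.
move=> hA; elim: j => [|j [P hP]].
  by exists [::] => chi; right; exists 0; [rewrite inE|exists [::]].
(* The point 0 serves as focus when no colour is focused yet. *)
set B := 0 :: _ in hP.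
have [Q hQ] := hA {ffun 'I_(size B) -> C}.
exists ([seq (q.1 + a0 *+ q.2 + p.1, p.2) | q <- Q, p <- P] ++
        [seq (q.1 + p.1, (q.2 + p.2)%N) | q <- Q, p <- P] ++
        [seq (q.1 + f, q.2) | q <- Q, f <- B]) => chi.
have [[s q] sqQ [/= q0 hq]] := hQ (fun x => [ffun i => chi (x + B`_(val i))]).
(* From here on, hq says that the blocks along the copy look the same. *)
have {}hq a b f : a \in a0 :: A -> b \in a0 :: A -> f \in B ->
    chi (s + a *+ q + f) = chi (s + b *+ q + f).
  move=> ha hb hf; have hi : (index f B < size B)%N by rewrite index_mem.
  have := hq a b ha hb => /ffunP/(_ (Ordinal hi)).
  by rewrite !ffunE /= !nth_index.
have memB a p : a \in [:: e, a0 & A] -> p \in P -> p.1 + a *+ p.2 \in B.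
  move=> ha hp; rewrite inE; apply/orP; right.
  exact: (allpairs_f (fun p a => p.1 + a *+ p.2)).
set x0 := s + a0 *+ q.
have [[p pP [p0 hp]]|[f fB [l [ul sl hl]]]] := hP (fun y => chi (x0 + y)).
  left; exists (x0 + p.1, p.2).
    rewrite mem_cat; apply/orP; left.
    exact: (allpairs_f (fun q p => (q.1 + a0 *+ q.2 + p.1, p.2)) sqQ pP).
  by split=> //= a b ha hb; rewrite -!(addrA x0); exact: hp.
have a0A : a0 \in a0 :: A by rewrite mem_head.
have [/hl[p pP [p0 hf hp]]|cl] := boolP (chi (x0 + f) \in l).
  left; exists (x0 + p.1, p.2).
    rewrite mem_cat; apply/orP; left.
    exact: (allpairs_f (fun q p => (q.1 + a0 *+ q.2 + p.1, p.2)) sqQ pP).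
  split=> //= a b ha hb; rewrite -!(addrA x0).
  suff h a' : a' \in [:: e, a0 & A] ->
    chi (x0 + (p.1 + a' *+ p.2)) = chi (x0 + f) by rewrite !h.
  by rewrite inE => /predU1P[->|/hp//]; rewrite -hf.
right.
(* The foci of the blocks form the copy of a0 :: A with the new colour. *)
have newP : (s + f, q) \in [seq (q.1 + f, q.2) | q <- Q, f <- B].
  exact: (allpairs_f (fun q f => (q.1 + f, q.2)) sqQ fB).
exists (s + f + e *+ q).
  rewrite inE; apply/orP; right.
  apply: (@allpairs_f _ _ _ (fun p a => p.1 + a *+ p.2) _ _ (s + f, q) e).
    by rewrite !mem_cat newP !orbT.
  exact: mem_head.
exists (chi (x0 + f) :: l); split; rewrite /= ?cl ?ul ?sl//.
move=> c; rewrite inE => /predU1P[->|/hl[p pP [p0 hf hp]]].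
  exists (s + f, q); first by rewrite !mem_cat newP !orbT.
  split=> //= a ha; rewrite addrAC; exact: hq.
exists (s + p.1, (q + p.2)%N).
  rewrite !mem_cat (allpairs_f (fun q p => (q.1 + p.1, (q.2 + p.2)%N)) sqQ pP).
  by rewrite orbT.
split=> /=; first by rewrite addn_gt0 q0.
  by rewrite mulrnDr addrACA -hf addrAC.
move=> a ha; rewrite mulrnDr addrACA.
rewrite (hq a a0)// ?hp//.
by apply: memB => //; rewrite inE ha orbT.
Qed.

(** Induction on the pattern.  With one focused colour more than there are
    colours, the second alternative of [focusing] is impossible. *)
Lemma gallai (V : zmodType) (A : seq V) : partition_regular A.
Proof.
elim: A => [|e [|a0 A] IH] C.
- by exists [:: (0, 1%N)] => chi; exists (0, 1%N); [rewrite inE|].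
- exists [:: (0, 1%N)] => chi; exists (0, 1%N); first by rewrite inE.
  by split=> // a b; rewrite !inE => /eqP-> /eqP->.
have [P hP] := @focusing _ _ e _ C #|C|.+1 IH.
exists P => chi; have [//|[f _ [l [ul sl _]]]] := hP chi.
by have := uniq_leq_size ul (fun c _ => mem_enum C c); rewrite sl -cardE ltnn.
Qed.

(** * Linear algebra *)

Lemma row_free_adjoin (K : fieldType) k n (A : 'M[K]_(k, n)) (s : 'rV[K]_n)
    (u : 'cV[K]_n) :
  row_free A -> A *m u = 0 -> s *m u != 0 -> row_free (col_mx s A).
Proof.
move=> Afree Au su; apply/inj_row_free => v.
rewrite -[v]hsubmxK mul_row_col [lsubmx v]mx11_scalar mul_scalar_mx.
set c := lsubmx v 0 0 => cA; suff c0 : c = 0.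
  move: cA; rewrite c0 scale0r add0r => /eqP.
  by rewrite mulmx_free_eq0// => /eqP ->; rewrite raddf0 row_mx0.
have : (c *: s + rsubmx v *m A) *m u = 0 by rewrite cA mul0mx.
rewrite mulmxDl -mulmxA Au mulmx0 addr0 -scalemxAl => /eqP.
by rewrite scaler_eq0 (negPf su) orbF => /eqP.
Qed.

(** An independent family in S of maximal size has n members: otherwise a
    nonzero functional kills the family, hence by maximality all of S. *)
Lemma spanning_set_contains_basis (K : fieldType) n (S : set 'rV[K]_n) :
  (forall u : 'cV[K]_n, (forall s, S s -> s *m u = 0) -> u = 0) ->
  exists2 A : 'M[K]_n, A \in unitmx & forall i, S (row i A).
Proof.
move=> spanS.
pose P k := `[< exists A : 'M[K]_(k, n), row_free A /\ forall i, S (row i A) >].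
have P0 : exists k, P k.
  exists 0%N; apply/asboolP; exists 0; split=> [|[]//].
  by rewrite /row_free mxrank0.
have Pn k : P k -> (k <= n)%N.
  by move=> /asboolP[A [/eqP Ak _]]; rewrite -Ak rank_leq_col.
case: (ex_maxnP P0 Pn) => k /asboolP[A [Afree SA]] kmax.
have [kn|kn] := eqVneq k n; first by subst k; exists A; rewrite -?row_free_unit.
suff coker0 : cokermx A = 0.
  have := mxrank_coker A; rewrite coker0 mxrank0 (eqP Afree) => /esym/eqP.
  by rewrite subn_eq0 leqNgt ltn_neqAle kn Pn//; apply/asboolP; exists A.
apply/matrixP => i j; rewrite mxE; set u := col j (cokermx A).
suff u0 : u = 0 by have /matrixP/(_ i 0) := u0; rewrite !mxE.
have Au : A *m u = 0 by rewrite /u colE mulmxA mulmx_coker mul0mx.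
apply: spanS => s Ss; apply/eqP; apply: contraT => su.
suff /kmax : P k.+1 by rewrite ltnn.
apply/asboolP; exists (col_mx s A : 'M[K]_(1 + k, n)); split.
  exact: (row_free_adjoin Afree Au).
suff h (l : 'I_(1 + k)) : S (row l (col_mx s A)) by exact: h.
have [l' ->|l' ->] := split_ordP l; last by rewrite rowKd.
by rewrite rowKu ord1 row_id.
Qed.

(** A rational kernel vector exists for dimension reasons; its denominators are
    cleared by multiplying by their product. *)
Lemma int_dependent (k n : nat) (c : 'I_k -> 'I_n -> int) : (n < k)%N ->
  exists2 e : 'I_k -> int, exists i, e i != 0 &
    forall j, \sum_i c i j * e i = 0.
Proof.
move=> nk; pose M : 'M[rat]_(k, n) := \matrix_(i, j) (c i j)%:~R.
have kerM : kermx M != 0.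
  rewrite -mxrank_eq0 mxrank_ker -lt0n subn_gt0.
  exact: leq_ltn_trans (rank_leq_col _) nk.
have [i0 [i1 kM01]] : exists i0 i1, kermx M i0 i1 != 0.
  apply: contrapT => h; move/eqP: kerM; apply; apply/matrixP => i j.
  by rewrite [RHS]mxE; apply/eqP/negPn/negP => hij; apply: h; exists i, j.
pose v i := kermx M i0 i.
have vM j : \sum_i v i * (c i j)%:~R = 0.
  have /matrixP/(_ i0 j) := mulmx_ker M.
  rewrite [LHS]mxE [RHS]mxE; apply: etrans.
  by apply: eq_bigr => i _; congr (_ * _); rewrite [RHS]mxE.
pose D := \prod_i denq (v i).
pose e i := numq (v i) * \prod_(l | l != i) denq (v l).
have eE i : (e i)%:~R = v i * D%:~R.
  have -> : D = denq (v i) * \prod_(l | l != i) denq (v l).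
    by rewrite /D (bigD1 i).
  rewrite /e !intrM mulrA; congr (_ * _).
  exact: numqE.
have D0 : D%:~R != 0 :> rat.
  by rewrite intr_eq0; apply/prodf_neq0 => i _; exact: denq_neq0.
exists e.
  by exists i1; rewrite -(intr_eq0 rat) eE mulf_neq0.
move=> j; apply/eqP; rewrite -(intr_eq0 rat) rmorph_sum /=.
under eq_bigr do rewrite intrM eE mulrA [_ * v _]mulrC.
by rewrite -mulr_suml vM mul0r.
Qed.

Lemma zfree_unitmx (R : realType) n (A : 'M[R]_n) :
  A \in unitmx -> zfree (fun i => row i A).
Proof.
move=> Au c cA j.
have : (\row_i (c i)%:~R) *m A = 0.
  rewrite mulmx_sum_row -[RHS]cA; apply: eq_bigr => i _.
  by rewrite mxE scaler_int.
move=> /(congr1 (mulmx^~ (invmx A))); rewrite mulmxK// mul0mx => /rowP/(_ j).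
by rewrite !mxE => /eqP; rewrite intr_eq0 => /eqP.
Qed.

(** * Subgroups and progressions *)

Section Subgroup.
Variables (V : zmodType) (H : set V).
Hypothesis sH : is_subgroup H.

Lemma subgroup0 : H 0. Proof. by case: sH. Qed.

Lemma subgroupB x y : H x -> H y -> H (x - y).
Proof. by case: sH => _; apply. Qed.

Lemma subgroupN x : H x -> H (- x).
Proof. by rewrite -sub0r; apply: subgroupB; exact: subgroup0. Qed.

Lemma subgroupD x y : H x -> H y -> H (x + y).
Proof. by move=> Hx Hy; rewrite -[y]opprK; apply/subgroupB/subgroupN. Qed.

Lemma subgroup_mulrn x k : H x -> H (x *+ k).
Proof.
move=> Hx; elim: k => [|k IH]; first by rewrite mulr0n; exact: subgroup0.
by rewrite mulrS; exact: subgroupD.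
Qed.

Lemma subgroup_mulrz x (k : int) : H x -> H (x *~ k).
Proof.
by move=> Hx; case: k => k; [|apply: subgroupN]; exact: subgroup_mulrn.
Qed.

Lemma subgroup_sum (I : Type) (s : seq I) (F : I -> V) :
  (forall i, H (F i)) -> H (\sum_(i <- s) F i).
Proof.
by move=> HF; apply: big_ind => //; [exact: subgroup0|exact: subgroupD].
Qed.

Lemma subgroup_zcomb (I : Type) (s : seq I) (F : I -> V) (c : I -> int) :
  (forall i, H (F i)) -> H (\sum_(i <- s) F i *~ c i).
Proof. by move=> HF; apply: subgroup_sum => i; exact: subgroup_mulrz. Qed.
End Subgroup.

Lemma contains_li_apS (V : zmodType) N k (A B : set V) :
  A `<=` B -> contains_li_ap N k A -> contains_li_ap N k B.
Proof. by move=> AB [P Pap PA]; exists P => //; exact: subset_trans AB. Qed.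

(** * Maximum norm and Euclidean norm *)

Lemma coord_le_norm (R : realType) n (x : 'rV[R]_n) i : `|x 0 i| <= `|x|.
Proof.
rewrite [leRHS]mx_normrE.
exact: (le_bigmax _ (fun ij : 'I_1 * 'I_n => `|x ij.1 ij.2|) (0, i)).
Qed.

Lemma norm_le_coord (R : realType) n (x : 'rV[R]_n) r :
  0 <= r -> (forall i, `|x 0 i| <= r) -> `|x| <= r.
Proof.
move=> r0 h; rewrite [leLHS]mx_normrE; apply: bigmax_le => // -[i j] _ /=.
by rewrite ord1.
Qed.

Lemma norm_lsubmx (R : realType) d m (v : 'rV[R]_(d + m)) : `|lsubmx v| <= `|v|.
Proof. by apply: norm_le_coord => // i; rewrite mxE coord_le_norm. Qed.

Lemma norm_rsubmx (R : realType) d m (v : 'rV[R]_(d + m)) : `|rsubmx v| <= `|v|.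
Proof. by apply: norm_le_coord => // i; rewrite mxE coord_le_norm. Qed.

Lemma norm_row_mx (R : realType) d m (x : 'rV[R]_d) (y : 'rV[R]_m) r :
  0 <= r -> `|x| <= r -> `|y| <= r -> `|row_mx x y| <= r.
Proof.
move=> r0 xr yr; apply: norm_le_coord => // i.
have [j ->|j ->] := split_ordP i.
  by rewrite row_mxEl (le_trans (coord_le_norm _ _)).
by rewrite row_mxEr (le_trans (coord_le_norm _ _)).
Qed.

Lemma norm_mul_col (R : realType) n (v : 'rV[R]_n) (u : 'cV[R]_n) :
  `|(v *m u) 0 0| <= `|v| * \sum_i `|u i 0|.
Proof.
rewrite mxE (le_trans (ler_norm_sum _ _ _))// mulr_sumr.
by apply: ler_sum => i _; rewrite normrM ler_wpM2r// coord_le_norm.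
Qed.

Lemma ler_norm_zcomb (R : realType) (V : normedModType R) n
    (a : 'I_n -> V) (c : 'I_n -> int) (M : nat) :
  (forall i, `|c i| <= M%:Z) ->
  `|\sum_i a i *~ c i| <= M%:R * \sum_i `|a i|.
Proof.
move=> cM; rewrite (le_trans (ler_norm_sum _ _ _))// mulr_sumr.
apply: ler_sum => i _; rewrite -scaler_int normrZ ler_wpM2r//.
by rewrite -intr_norm -[M%:R]/(M%:Z%:~R) ler_int.
Qed.

Lemma int_entries_bounded n (X : seq 'rV[int]_n) :
  exists M : nat, forall x, x \in X -> forall j, `|x 0 j| <= M%:Z.
Proof.
exists (\max_(x <- X) \max_j `|x 0%R j|%N) => x xX j.
rewrite -abszE lez_nat.
apply: (@leq_trans (\max_j `|x 0%R j|%N)).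
  exact: (leq_bigmax j).
exact: (leq_bigmax_seq x).
Qed.

Lemma norm_le_euclidean (R : realType) n (x : 'rV[R]_n) :
  `|x| <= Num.sqrt (\sum_(i < n) x 0 i ^+ 2).
Proof.
apply: norm_le_coord => [|i]; first exact: sqrtr_ge0.
rewrite -sqrtr_sqr ler_wsqrtr// (bigD1 i)//= lerDl.
by apply: sumr_ge0 => j _; exact: sqr_ge0.
Qed.

Lemma euclidean_le_norm (R : realType) n (x : 'rV[R]_n) :
  Num.sqrt (\sum_(i < n) x 0 i ^+ 2) <= n%:R * `|x|.
Proof.
rewrite -[leRHS]ger0_norm ?mulr_ge0// -sqrtr_sqr ler_wsqrtr//.
apply: (@le_trans _ _ (\sum_(i < n) `|x| ^+ 2)).
  apply: ler_sum => i _; rewrite -real_normK ?num_real//.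
  by rewrite lerXn2r ?nnegrE// coord_le_norm.
rewrite sumr_const card_ord -[leLHS]mulr_natl exprMn ler_wpM2r ?exprn_ge0//.
by rewrite -natrX ler_nat; case: n {x} => // n; rewrite leq_pmulr.
Qed.

Lemma eball_norm (R : realType) n (x y : 'rV[R]_n) (r : R) :
  eball y r x -> `|x - y| < r.
Proof.
apply: le_lt_trans; apply: le_trans (norm_le_euclidean _) _.
rewrite (_ : \sum_(i < n) (x - y) 0 i ^+ 2 = \sum_i (x 0 i - y 0 i) ^+ 2) //.
by apply: eq_bigr => i _; rewrite !mxE.
Qed.

Lemma norm_eball (R : realType) n (x y : 'rV[R]_n) (r : R) : (0 < n)%N ->
  `|x - y| < r -> eball y (n%:R * r) x.
Proof.
move=> n0 xy; rewrite /eball /= (_ : \sum_(_ < _) _ = \sum_i (x - y) 0 i ^+ 2).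
  by rewrite (le_lt_trans (euclidean_le_norm _))// ltr_pM2l// ltr0n.
by apply: eq_bigr => i _; rewrite !mxE.
Qed.

(** * Rounding in a basis *)

Definition frac (R : realType) (x : R) := x - (Num.floor x)%:~R.

Lemma frac_ge0 (R : realType) (x : R) : 0 <= frac x.
Proof. by rewrite subr_ge0 floor_le. Qed.

Lemma frac_lt1 (R : realType) (x : R) : frac x < 1.
Proof. by rewrite ltrBlDl; have := floorD1_gt x; rewrite intrD addrC. Qed.

Lemma ler_norm_frac_comb (R : realType) (V : normedModType R) n
    (t : 'I_n -> R) (w : 'I_n -> V) :
  `|\sum_i frac (t i) *: w i| <= \sum_i `|w i|.
Proof.
apply: le_trans (ler_norm_sum _ _ _) _; apply: ler_sum => i _.
rewrite normrZ ler_piMl// ger0_norm ?frac_ge0//; exact/ltW/frac_lt1.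
Qed.

(** Rounding down the coordinates in the basis A gives an integral combination
    whose distance to v is bounded independently of v. *)
Lemma round_comb (R : realType) n (A : 'M[R]_n) (v : 'rV[R]_n) :
  A \in unitmx -> let t := v *m invmx A in
  v = \sum_i row i A *~ Num.floor (t 0 i) + \sum_i frac (t 0 i) *: row i A.
Proof.
move=> Au t; rewrite -[LHS](mulmxKV Au) mulmx_sum_row -big_split /=.
apply: eq_bigr => i _; rewrite -scaler_int -scalerDl; congr (_ *: _).
by rewrite /frac addrC subrK.
Qed.

(** * Lattices *)

Definition locally_finite (R : realType) n (G : set 'rV[R]_n) :=
  forall r, finite_set (G `&` [set v | `|v| <= r]).

(** The images of the balls of radius k around 0 form an increasing open cover
    of the quotient; by compactness a single one of them is everything. *)
Lemma cocompact_relatively_dense (R : realType) (V : normedModType R)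
    (L : set V) (sL : is_subgroup L) :
  compact [set: coset_space sL] ->
  exists2 r : R, 0 < r & forall v, exists2 l, L l & `|v - l| < r.
Proof.
move=> /compact_near_coveringP cL.
pose pi : V -> coset_space sL := \pi_({eq_quot (coset_equiv sL)})%qT.
have piP x y : pi x = pi y <-> L (x - y).
  by split => [/eqmodP/asboolP//|Lxy]; apply/eqmodP/asboolP.
pose U (k : nat) (c : coset_space sL) := exists v : V, `|v| < k%:R /\ pi v = c.
have oU k : open (U k).
  rewrite /open /= /quotient_open openE => v [w [wk /piP Lwv]].
  apply/nbhs_ballP; exists (k%:R - `|w|); first by rewrite /= subr_gt0.
  rewrite -ball_normE => v' /= vv'; exists (w + (v' - v)); split.
    rewrite (le_lt_trans (ler_normD _ _))// -ltrBrDl.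
    by rewrite distrC.
  by apply/piP; rewrite addrA addrAC addrK.
have [k _ hk] : \forall k \near \oo, [set: coset_space sL] `<=` U k.
  apply: cL => c _.
  have [v0 v0c] : exists v0, pi v0 = c.
    by exists (repr c); exact: reprK.
  pose k0 := (Num.truncn `|v0|).+1.
  have Uc : U k0 c by exists v0; split => //; exact: truncnS_gt.
  exists (U k0, [set k | (k0 <= k)%N]) => /=.
    split; last exact: nbhs_infty_ge.
    exact: (@open_nbhs_nbhs (coset_space sL) c (U k0) (conj (oU k0) Uc)).
  move=> [c' k] /= [[v [vk <-]] k0k]; exists v; split => //.
  by rewrite (lt_le_trans vk)// ler_nat.
exists k.+1%:R; first by rewrite ltr0n.
move=> v; have [w [wk /piP Lwv]] := hk _ (leqnSn k) (pi v) I.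
exists (v - w); first by rewrite -opprB; apply: subgroupN Lwv.
by rewrite opprB addrC subrK.
Qed.

Lemma discrete_separated (R : realType) d m (L : set ('rV[R]_d * 'rV[R]_m)) :
  is_subgroup L -> L `<=` isolated L ->
  exists2 e : R, 0 < e & forall l, L l -> `|l.1| < e -> `|l.2| < e -> l = 0.
Proof.
move=> sL isoL; have [_ [N]] := isoL _ (subgroup0 sL).
move=> /nbhs_ballP[e /= e0 eN] N0; exists e => // -[x y] Lxy /= xe ye.
have : (N `&` L) (x, y).
  split=> //; apply: eN; split => /=; rewrite -ball_normE /=.
    by rewrite sub0r normrN.
  by rewrite sub0r normrN.
by rewrite N0.
Qed.

(** Grid argument: cubes of side e / 2 contain at most one point of G each, and
    only finitely many of them meet a given ball. *)
Lemma separated_locally_finite (R : realType) n (G : set 'rV[R]_n) (e : R) :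
  0 < e -> is_subgroup G -> (forall g, G g -> `|g| < e -> g = 0) ->
  locally_finite G.
Proof.
move=> e0 sG Ge r; set A := _ `&` _.
pose N := Num.truncn ((r + r) * (2 / e)).
(* Coordinates are shifted by r, hence nonnegative on the ball of radius r. *)
pose idx (g : 'rV[R]_n) i := Num.truncn ((g 0 i + r) * (2 / e)).
pose cell (g : 'rV[R]_n) := [ffun i : 'I_n => inord (idx g i) : 'I_N.+1].
have e2 : 0 < 2 / e by rewrite divr_gt0.
have r0 g i : A g -> 0 <= (g 0 i + r) * (2 / e) <= (r + r) * (2 / e).
  move=> [_ /= gr]; have := le_trans (coord_le_norm g i) gr.
  rewrite ler_norml => /andP[h1 h2].
  by rewrite mulr_ge0 ?(ltW e2)//= ?ler_pM2r//; lra.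
have cellE g i : A g -> (cell g i : nat) = idx g i.
  move=> Ag; rewrite ffunE inordK// ltnS le_truncn//.
  by have /andP[] := r0 _ i Ag.
have inj : {in A &, injective cell}.
  move=> g h /set_mem Ag /set_mem Ah /ffunP gh; apply/eqP; rewrite -subr_eq0.
  apply/eqP; apply: Ge; first by apply: (subgroupB sG); [case: Ag|case: Ah].
  apply: (@le_lt_trans _ _ (e / 2)); last by rewrite ltr_pdivrMr//; lra.
  apply: norm_le_coord => [|i]; first by rewrite divr_ge0// ltW.
  have := congr1 (@nat_of_ord _) (gh i); rewrite !cellE// /idx.
  have /andP[/truncn_itv/andP[g1 g2] _] := r0 _ i Ag.
  have /andP[/truncn_itv/andP[h1 h2] _] := r0 _ i Ah.
  move=> E; rewrite E in g1 g2; rewrite -natr1 in g2 h2.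
  rewrite -(ler_pM2r e2) -[X in _ * X](gtr0_norm e2) -normrM.
  rewrite mxE [X in _ + X]mxE.
  have -> : e / 2 * (2 / e) = 1 by field; rewrite gt_eqF.
  rewrite ler_norml; apply/andP; split; lra.
have /card_eqPle[_ /card_le_finite] := inj_card_eq inj; apply.
exact: finite_finset.
Qed.

Section Lattice.
Variables (R : realType) (n : nat) (G : set 'rV[R]_n).
Hypotheses (sG : is_subgroup G) (finG : locally_finite G).

Lemma lattice_remainder (A : 'M[R]_n) g :
    A \in unitmx -> (forall i, G (row i A)) -> G g ->
  G (\sum_i frac ((g *m invmx A) 0 i) *: row i A).
Proof.
move=> Au GA Gg.
rewrite -[X in G X](addKr (\sum_i row i A *~ Num.floor ((g *m invmx A) 0 i))).
rewrite -round_comb// addrC; apply: (subgroupB sG) => //.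
exact: subgroup_zcomb.
Qed.

(** For g in G the remainders of the multiples k g modulo A lie in one finite
    set, which does not depend on g.  Two of the first remainders agree, so some
    positive multiple of g by a bounded integer is an integral combination of
    the rows of A; a factorial is a common multiple of all these integers. *)
Lemma lattice_denominator (A : 'M[R]_n) :
    A \in unitmx -> (forall i, G (row i A)) ->
  exists2 K, (0 < K)%N & forall g, G g ->
    exists c : 'I_n -> int, forall j, K%:R * (g *m invmx A) 0 j = (c j)%:~R.
Proof.
move=> Au GA.
have [s sE] := (finite_seqP _).1 (finG (\sum_i `|row i A|)).
exists (size s)`!; first exact: fact_gt0.
move=> g Gg.
pose f k : 'rV[R]_n := \sum_i frac ((g *+ k *m invmx A) 0 i) *: row i A.
have fs k : (k <= size s)%N -> f k \in s.
  move=> _; suff : [set` s] (f k) by [].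
  rewrite -sE; split; last exact: ler_norm_frac_comb.
  apply: lattice_remainder => //; exact: subgroup_mulrn.
have [k [l [kl ls fkl]]] := finite_pigeonhole fs.
have fE k' : f k' = (\row_i frac ((g *+ k' *m invmx A) 0 i)) *m A.
  by rewrite mulmx_sum_row; apply: eq_bigr => i _; rewrite [in RHS]mxE.
move: fkl; rewrite !fE => /(can_inj (mulmxK Au))/rowP fkl.
have lk0 : (0 < l - k)%N by rewrite subn_gt0.
have lkK : (l - k %| (size s)`!)%N.
  by rewrite dvdn_fact// lk0 (leq_trans (leq_subr _ _) ls).
set t := g *m invmx A.
have tE k' : g *+ k' *m invmx A = t *+ k'.
  exact: (raddfMn (mulmxr (invmx A))).
exists (fun j => (((size s)`! %/ (l - k))%N)%:Z *
   (Num.floor ((t *+ l) 0 j) - Num.floor ((t *+ k) 0 j))) => j.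
have := fkl j; rewrite [LHS]mxE [RHS]mxE !tE /frac => tkl.
have tlk : (t *+ l) 0 j - (t *+ k) 0 j = (l - k)%:R * t 0 j.
  by rewrite !mulmxnE -mulrnBr 1?ltnW// mulr_natl.
rewrite intrM intrB.
have -> : (Num.floor ((t *+ l) 0 j))%:~R - (Num.floor ((t *+ k) 0 j))%:~R =
          (l - k)%:R * t 0 j :> R.
  by rewrite -tlk; lra.
by rewrite mulrA -pmulrn -natrM divnK.
Qed.

(** K times the matrix of B in the basis A has integer entries, hence an integer
    determinant. *)
Lemma lattice_volume_nat (A : 'M[R]_n) (K : nat) :
    A \in unitmx ->
    (forall g, G g ->
      exists c : 'I_n -> int,
        forall j, K%:R * (g *m invmx A) 0 j = (c j)%:~R) ->
  forall B : 'M[R]_n, (forall i, G (row i B)) ->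
  exists v : nat, `|\det B| * (K%:R ^+ n / `|\det A|) = v%:R.
Proof.
move=> Au hK B GB.
have [c hc] := choice (fun i => hK _ (GB i)).
exists `|\det (\matrix_(i, j) c i j)|%N.
rewrite natr_absz intr_norm.
have -> : (\det (\matrix_(i, j) c i j))%:~R =
          \det (K%:R *: (B *m invmx A)) :> R.
  rewrite -(det_map_mx (intmul 1)); congr (\det _); apply/matrixP => i j.
  rewrite [LHS]mxE [in LHS]mxE /= -hc [RHS]mxE; congr (_ * _).
  by rewrite -row_mul mxE.
rewrite detZ det_mulmx det_inv !normrM normfV normrX normr_nat.
by rewrite mulrCA.
Qed.

(** A basis B in G of minimal volume is a Z-basis: if some g had a coordinate
    with nonzero fractional part c, replacing the corresponding row of B by the
    remainder of g modulo B would multiply the volume by c < 1.  The minimum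
    exists because volumes are natural numbers up to a common factor. *)
Lemma lattice_Zbasis (A : 'M[R]_n) :
    A \in unitmx -> (forall i, G (row i A)) ->
  exists B : 'M[R]_n, [/\ B \in unitmx, forall i, G (row i B) &
    forall g, G g -> exists c : 'I_n -> int, g = \sum_i row i B *~ c i].
Proof.
move=> Au GA; have [K K0 hK] := lattice_denominator Au GA.
set w := K%:R ^+ n / `|\det A| : R.
have w0 : 0 < w.
  by rewrite divr_gt0 ?exprn_gt0 ?ltr0n// normr_gt0 -unitfE -unitmxE.
pose P v := `[< exists B : 'M[R]_n, [/\ B \in unitmx, forall i, G (row i B) &
   `|\det B| * w = v%:R] >].
have P0 : exists v, P v.
  have [v hv] := lattice_volume_nat Au hK GA.
  by exists v; apply/asboolP; exists A.
case: (ex_minnP P0) => v /asboolP[B [Bu GB vB]] vmin.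
exists B; split=> // g Gg; set t := g *m invmx B.
exists (fun i => Num.floor (t 0 i)).
rewrite [LHS](round_comb _ Bu) -/t [X in _ + X]big1 ?addr0// => i _.
suff -> : frac (t 0 i) = 0 by rewrite scale0r.
apply/eqP; apply: contraT => fi0.
have fi_gt0 : 0 < frac (t 0 i) by rewrite lt_neqAle eq_sym fi0 frac_ge0.
pose g' : 'rV_n := \sum_i frac (t 0 i) *: row i B.
pose B' := \matrix_k (if k == i then g' else row k B).
have GB' k : G (row k B').
  by rewrite rowK; case: ifP => // _; exact: lattice_remainder.
have detB' : \det B' = \det B * frac (t 0 i).
  rewrite (expand_det_row _ i).
  transitivity ((g' *m \adj B) 0 i).
    rewrite mxE; apply: eq_bigr => k _; rewrite !mxE eqxx; congr (_ * _).
    rewrite /cofactor; congr (_ * \det _); apply/matrixP => a b.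
    by rewrite !mxE eq_sym (negPf (neq_lift _ _)) mxE.
  have -> : g' = (\row_k frac (t 0 k)) *m B.
    by rewrite mulmx_sum_row; apply: eq_bigr => k _; rewrite [in RHS]mxE.
  by rewrite -mulmxA mul_mx_adj mul_mx_scalar !mxE.
have B'u : B' \in unitmx.
  by rewrite unitmxE detB' unitrM -unitmxE Bu unitfE.
have [v' hv'] := lattice_volume_nat Au hK GB'.
have /vmin : P v' by apply/asboolP; exists B'.
rewrite leqNgt => /negP[].
rewrite -(ltr_nat R) -hv' -vB detB' normrM (gtr0_norm fi_gt0).
by rewrite ltr_pM2r// gtr_pMr ?frac_lt1// normr_gt0 -unitfE -unitmxE.
Qed.
End Lattice.

(** * Cut and project schemes *)

Section CutAndProject.
Variables (R : realType) (d m : nat) (L : set ('rV[R]_d * 'rV[R]_m)).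
Hypotheses (sL : is_subgroup L) (isoL : L `<=` isolated L).
Hypothesis cocL : exists2 r : R, 0 < r &
  forall v, exists2 l, L l & `|v - l| < r.
Hypotheses (injL : set_inj L fst) (denseL : dense (snd @` L)).

(** Halving: if |l.2| < 2 r, density of the second projection gives g in L such
    that g.2 is close to l.2 / 2, and then both g.2 and (l - g).2 are shorter
    than r. *)
Lemma strip_generates (e : R) (H : set ('rV[R]_d * 'rV[R]_m)) :
  0 < e -> is_subgroup H -> (forall l, L l -> `|l.2| < e -> H l) -> L `<=` H.
Proof.
move=> e0 sH He.
suff h k l : L l -> `|l.2| < 2 ^+ k * e -> H l.
  move=> l Ll; apply: (h (Num.truncn (`|l.2| / e)).+1 l) => //.
  rewrite -ltr_pdivrMr// (lt_le_trans (truncnS_gt _))// -natrX ler_nat.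
  exact/ltnW/ltn_expl.
elim: k l => [|k IH] l Ll; first by rewrite expr0 mul1r; exact: He.
rewrite exprS -mulrA; set r := _ * e => l2r.
have [z [[/= mid1 mid2] [g Lg g2]]] :
    (ball 0 r `&` ball l.2 r `&` (snd @` L)) !=set0.
  apply: denseL; last by apply: openI; exact: ball_open.
  exists (2^-1 *: l.2); split; rewrite -ball_normE /=.
    rewrite sub0r normrN normrZ gtr0_norm ?invr_gt0// mulrC ltr_pdivrMr//.
    by rewrite mulrC.
  rewrite -{1}[l.2]scale1r -scalerBl (_ : 1 - 2^-1 = 2^-1); last lra.
  rewrite normrZ gtr0_norm ?invr_gt0// mulrC ltr_pdivrMr//.
  by rewrite mulrC.
rewrite -[l](subrK g); apply: (subgroupD sH); apply: IH => //.
- exact: (subgroupB sL).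
- by move: mid2; rewrite -ball_normE /= -g2.
- by move: mid1; rewrite -ball_normE /= -g2 sub0r normrN.
Qed.

(** The lattice as a set of row vectors of length d + m, to which determinants
    and ranks apply. *)
Definition joined : set 'rV[R]_(d + m) := [set v | L (lsubmx v, rsubmx v)].

Lemma joined_row_mx l : L l -> joined (row_mx l.1 l.2).
Proof. by case: l => x y Ll; rewrite /joined /= row_mxKl row_mxKr. Qed.

Lemma is_subgroup_joined : is_subgroup joined.
Proof.
split=> [|x y]; first by rewrite /joined /= !linear0; exact: (subgroup0 sL).
by rewrite /joined /= !linearB => Lx Ly; exact: (subgroupB sL Lx Ly).
Qed.

Lemma locally_finite_joined : locally_finite joined.
Proof.
have [e e0 Le] := discrete_separated sL isoL.
apply: (separated_locally_finite e0 is_subgroup_joined) => v Lv ve.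
have [l0 r0] := Le _ Lv (le_lt_trans (norm_lsubmx v) ve)
                        (le_lt_trans (norm_rsubmx v) ve).
by rewrite -[v]hsubmxK l0 r0 row_mx0.
Qed.

Lemma joined_lsubmx_eq0 v : joined v -> lsubmx v = 0 -> v = 0.
Proof.
move=> Lv v0; have := injL (mem_set Lv) (mem_set (subgroup0 sL)) v0.
by move=> [_ r0]; rewrite -[v]hsubmxK v0 r0 row_mx0.
Qed.

Lemma zfree_lsubmx k (a : 'I_k -> 'rV[R]_(d + m)) :
  (forall i, joined (a i)) -> zfree a -> zfree (fun i => lsubmx (a i)).
Proof.
move=> La fa c ca; apply: fa; apply: joined_lsubmx_eq0.
  exact: (subgroup_zcomb is_subgroup_joined).
by rewrite linear_sum /= -[RHS]ca; apply: eq_bigr => i _; exact: raddfMz.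
Qed.

(** A functional u that kills the short vectors kills L, since they generate L.
    Every vector is within bounded distance of L, so u is bounded on the whole
    space, hence zero. *)
Lemma short_star_basis (e : R) : 0 < e ->
  exists A : 'M[R]_(d + m), [/\ A \in unitmx, forall i, joined (row i A) &
    forall i, `|rsubmx (row i A)| < e].
Proof.
move=> e0.
have [u uS|A Au AS] := @spanning_set_contains_basis R (d + m)
    (joined `&` [set v | `|rsubmx v| < e]); last first.
  by exists A; split=> // i; case: (AS i).
have Lu : L `<=` [set l | row_mx l.1 l.2 *m u = 0].
  apply: (strip_generates e0) => [|l Ll le].
    split=> [|x y /= xu yu]; first by rewrite /= row_mx0 mul0mx.
    by rewrite -add_row_mx -opp_row_mx mulmxBl xu yu subr0.
  by apply: uS; split; [exact: joined_row_mx|rewrite /= row_mxKr].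
have [r r0 rL] := cocL.
set B := r * \sum_i `|u i 0|.
have uB (v : 'rV_(d + m)) : `|(v *m u) 0 0| <= B.
  have [l Ll vl] := rL (lsubmx v, rsubmx v).
  have -> : v *m u = (v - row_mx l.1 l.2) *m u by rewrite mulmxBl Lu// subr0.
  rewrite (le_trans (norm_mul_col _ _))// ler_wpM2r ?sumr_ge0//.
  rewrite -[v]hsubmxK opp_row_mx add_row_mx.
  move: vl; rewrite prod_normE /= gt_max => /andP[vl1 vl2].
  by apply: norm_row_mx; exact: ltW.
apply/colP => i; rewrite mxE; apply/eqP; apply: contraT => ui0.
have := uB (((B + 1) / u i 0) *: delta_mx 0 i).
rewrite -scalemxAl -rowE !mxE divfK//.
have B0 : 0 <= B by rewrite mulr_ge0 ?sumr_ge0// ltW.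
by rewrite ger0_norm ?addr_ge0// gerDl ler10.
Qed.

(** Round (y, w) in a basis of vectors whose second components are so short that
    the second component of the remainder is less than e. *)
Lemma model_set_relatively_dense (e : R) : 0 < e ->
  exists2 r : R, 0 < r & forall y w,
    exists2 l, L l & `|l.1 - y| < r /\ `|l.2 - w| < e.
Proof.
move=> e0; pose e' := e / (d + m).+1%:R.
have [|A [Au LA Ae]] := @short_star_basis e'; first by rewrite divr_gt0.
exists (\sum_i `|lsubmx (row i A)| + 1); first by rewrite ltr_wpDl ?sumr_ge0.
move=> y w; have /= := round_comb (row_mx y w) Au.
set g := \sum_i _ *~ _; set f := \sum_i _ *: _ => vE.
have Lg : joined g by apply: (subgroup_zcomb is_subgroup_joined).
exists (lsubmx g, rsubmx g) => //=.
have -> : lsubmx g - y = - lsubmx f.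
  by rewrite -[y](row_mxKl y w) vE linearD opprD addNKr.
have -> : rsubmx g - w = - rsubmx f.
  by rewrite -[w](row_mxKr y w) vE linearD opprD addNKr.
rewrite !normrN /f !linear_sum /=.
rewrite (eq_bigr _ (fun i _ => linearZ _ (row i A))).
rewrite [X in _ /\ `|X| < _](eq_bigr _ (fun i _ => linearZ _ (row i A))).
split; first by rewrite (le_lt_trans (ler_norm_frac_comb _ _))// ltrDl.
apply: le_lt_trans (ler_norm_frac_comb _ _) _.
apply: (@le_lt_trans _ _ (\sum_(i < d + m) e')).
  by apply: ler_sum => i _; exact/ltW/Ae.
rewrite sumr_const card_ord -mulr_natr /e' mulrAC ltr_pdivrMr//.
by rewrite ltr_pM2l// ltr_nat.
Qed.

Lemma projection_Zbasis : exists b : 'I_(d + m) -> 'rV[R]_d,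
  [/\ zfree b, forall j, (fst @` L) (b j) &
      forall x, (fst @` L) x ->
        exists c : 'I_(d + m) -> int, x = \sum_j b j *~ c j].
Proof.
have [A [Au LA _]] := short_star_basis ltr01.
have [B [Bu LB BL]] :=
  lattice_Zbasis is_subgroup_joined locally_finite_joined Au LA.
exists (fun j => lsubmx (row j B)); split.
- exact/zfree_lsubmx/zfree_unitmx.
- by move=> j; exists (lsubmx (row j B), rsubmx (row j B)) => //; exact: LB.
- move=> _ [l Ll <-]; have [c cE] := BL _ (joined_row_mx Ll).
  exists c; rewrite -[l.1](row_mxKl _ l.2) cE linear_sum /=.
  by apply: eq_bigr => j _; exact: raddfMz.
Qed.

Lemma zfree_projection_le k (a : 'I_k -> 'rV[R]_d) :
  zfree a -> (forall i, (fst @` L) (a i)) -> (k <= d + m)%N.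
Proof.
move=> fa La; have [b [_ _ bL]] := projection_Zbasis.
have [c aE] := choice (fun i => bL _ (La i)).
rewrite leqNgt; apply/negP => /int_dependent-/(_ c)[z [i zi0] zc].
move/eqP: zi0; apply; apply: fa.
under eq_bigr do rewrite aE mulrz_suml.
rewrite exchange_big big1// => j _.
under eq_bigr do rewrite -mulrzA.
by rewrite -mulrz_sumr zc mulr0z.
Qed.

(** If e is the radius of a ball inside W and l0 is a lattice point with second
    component near its centre, then l0 + l projects into the cut for every l in
    L with a short second component, and l is the difference of two such
    points. *)
Lemma has_rank_cut_project (W : set 'rV[R]_m) :
  interior W !=set0 -> has_rank (cut_project L W) (d + m).
Proof.
move=> [w0 /nbhs_ballP[e /= e0 eW]].
have [b [fb Lb bL]] := projection_Zbasis.
exists b; split => //; apply/seteqP; split.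
  apply: smallest_sub.
    split; first by exists (fun=> 0); rewrite big1// => j _; rewrite mulr0z.
    move=> x y /= [c ->] [c' ->]; exists (fun j => c j - c' j).
    by rewrite -sumrB; apply: eq_bigr => j _; rewrite mulrzBr.
  by move=> x [y _ Lxy]; apply: bL; exists (x, y).
move=> _ [c ->] H [sH WH]; apply: (subgroup_zcomb sH) => j.
have [l Ll <-] := Lb j.
have e20 : 0 < e / 2 by rewrite divr_gt0.
have [r _ /(_ 0 w0)[l0 Ll0 [_ l0w]]] := model_set_relatively_dense e20.
apply: (@strip_generates (e / 2) [set l | H l.1]) Ll => //.
  by split=> [|x y]; [exact: (subgroup0 sH)|exact: (subgroupB sH)].
have l0W l' : L l' -> `|l'.2| < e / 2 -> H (l' + l0).1.
  move=> Ll' le; apply: WH; exists (l' + l0).2.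
    apply: eW; rewrite -ball_normE /= distrC -addrA.
    by rewrite (le_lt_trans (ler_normD _ _))//; lra.
  by rewrite -surjective_pairing; exact: (subgroupD sL).
move=> l' Ll' l'e /=; rewrite -[l'.1](addrK l0.1); apply: (subgroupB sH).
  exact: l0W.
have := l0W _ (subgroup0 sL); rewrite normr0 add0r; exact.
Qed.

(** Pigeonhole along each direction: two of the points s + i r_j, where i runs
    up to the length of a list of F, use the same element of F, and their
    difference is a nonzero multiple of r_j in
    the projection of L. *)
Lemma ap_rank_le (W : set 'rV[R]_m) (F A : set 'rV[R]_d) k :
  finite_set F -> A `<=` [set x + f | x in cut_project L W & f in F] ->
  (forall N, contains_li_ap N k A) -> (k <= d + m)%N.
Proof.
move=> /finite_seqP[Fs ->] AWF /(_ (size Fs))[_ [s [r [fr ->]]] srA].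
have rL j : exists q : int, q != 0 /\ (fst @` L) (r j *~ q).
  have /choice[f fP] (i : nat) : exists f, (i <= size Fs)%N ->
      f \in Fs /\ cut_project L W (s + r j *+ i - f).
    have [iF|_] := boolP (i <= size Fs)%N; last by exists 0.
    have [x Wx [f /= fF xf]] :
        [set x + f | x in cut_project L W & f in [set` Fs]] (s + r j *+ i).
      apply/AWF/srA; exists (fun l => (if l == j then i else 0%N)%:Z).
        by move=> l; case: ifP.
      congr (_ + _); rewrite (bigD1 j)//= eqxx big1 ?addr0//.
      by move=> l /negPf ->; rewrite mulr0z.
    by exists f => _; split => //; rewrite -xf addrK.
  have [i iF|i [i' [ii' i'F fE]]] := @finite_pigeonhole _ Fs f.
    by have [] := fP i iF.
  have [_ [y _ Ly]] := fP _ (leq_trans (ltnW ii') i'F).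
  have [_ [y' _ Ly']] := fP _ i'F.
  exists (i' - i)%N%:Z; split; first by rewrite eqz_nat subn_eq0 -ltnNge.
  exists ((s + r j *+ i' - f i', y') - (s + r j *+ i - f i, y)).
    exact: (subgroupB sL).
  rewrite /= fE -pmulrn mulrnBr 1?ltnW// opprB addrA subrK opprD addrACA.
  by rewrite subrr add0r.
have [q qP] := choice rL.
apply: (@zfree_projection_le _ (fun j => r j *~ q j)); last first.
  by move=> j; case: (qP j).
move=> c rqc j.
have /eqP : q j * c j = 0.
  apply: (fr (fun j => q j * c j)); rewrite -[RHS]rqc.
  by apply: eq_bigr => l _; rewrite mulrzA.
by have [qj _] := qP j; rewrite mulf_eq0 (negPf qj) => /eqP.
Qed.

(** * Progressions in relatively dense subsets *)

(** If x is in the model set of the unit ball and a = x' + f is a point of A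
    near x, then x - x' is the projection of a lattice vector of bounded norm,
    and there are finitely many of those. *)
Lemma cut_covered_by_translates (W : set 'rV[R]_m) (F A : set 'rV[R]_d)
    (w r : R) :
  (forall y, W y -> `|y| <= w) -> finite_set F ->
  A `<=` [set x + f | x in cut_project L W & f in F] ->
  (forall x, exists2 a, A a & `|x - a| < r) ->
  exists D : seq 'rV[R]_d, forall x y, L (x, y) -> `|y| < 1 ->
    exists2 a, a \in D & A (x - a) /\ `|a| < r.
Proof.
move=> Ww /finite_seqP[Fs ->] AWF Ar.
set b := r + \sum_(f <- Fs) `|f| + (1 + w).
have [Gs GE] := (finite_seqP _).1 (locally_finite_joined b).
exists [seq lsubmx g - f | g <- Gs, f <- Fs] => x y Lxy y1.
have [a Aa xa] := Ar x; exists (x - a); last by rewrite subKr.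
have [x' [y' Wy' Lxy'] [f fF x'f]] := AWF _ Aa.
have -> : x - a = lsubmx (row_mx (x - x') (y - y')) - f.
  by rewrite row_mxKl -x'f opprD addrA.
apply: (allpairs_f (fun g f => lsubmx g - f)) => //.
suff : [set` Gs] (row_mx (x - x') (y - y')) by [].
rewrite -GE; split; first exact: (joined_row_mx (subgroupB sL Lxy Lxy')).
have r0 : 0 <= r by rewrite (le_trans _ (ltW xa)).
have F0 : 0 <= \sum_(f <- Fs) `|f| by rewrite sumr_ge0.
have w0 : 0 <= w by rewrite (le_trans _ (Ww _ Wy')).
have fb : `|f| <= \sum_(f <- Fs) `|f|.
  by rewrite (big_rem f)//= lerDl sumr_ge0.
apply: norm_row_mx => /=; rewrite /b.
- by rewrite !addr_ge0.
- rewrite (_ : x - x' = (x - a) + f); last by rewrite -x'f opprD addrA subrK.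
  rewrite (le_trans (ler_normD _ _))//; lra.
- rewrite (le_trans (ler_normB _ _))//; have := Ww _ Wy'; lra.
Qed.

(** The integer vector c encodes the point x c = l0.1 + sum_i c_i r_i, where the
    r_i are the projections of the short basis B.  Gallai's theorem applies to
    integer vectors, so that the coordinate bound M is known before B is chosen
    short enough for all points in question to stay in the model set of the unit
    ball. *)
Lemma relatively_dense_contains_li_ap (W : set 'rV[R]_m) (F A : set 'rV[R]_d)
    (w r : R) :
  (forall y, W y -> `|y| <= w) -> finite_set F ->
  A `<=` [set x + f | x in cut_project L W & f in F] ->
  (forall x, exists2 a, A a & `|x - a| < r) ->
  forall N, exists2 r' : R, 0 < r' & forall y,
    contains_li_ap N (d + m) (A `&` [set x | `|x - y| < r']).
Proof.
move=> Ww finF AWF Ar N; set n := (d + m)%N.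
have [D hD] := cut_covered_by_translates Ww finF AWF Ar.
pose T : seq 'rV[int]_n :=
  [seq \row_j (c j : nat)%:Z | c : {ffun 'I_n -> 'I_N.+1}].
have [P hP] := gallai T 'I_(size D).+1.
have [M hM] := int_entries_bounded (copies T P).
(* M n e < 1/2, and the starting point contributes less than 1/2 as well. *)
pose e : R := (2 * (M * n).+1%:R)^-1.
have [|B [Bu LB Be]] := @short_star_basis e; first by rewrite invr_gt0 mulr_gt0.
pose z (c : 'rV[int]_n) := \sum_i row i B *~ c 0 i.
have zD c c' q : z (c + c' *+ q) = z c + \sum_i row i B *~ q%:Z *~ c' 0 i.
  rewrite -big_split; apply: eq_bigr => i _ /=.
  by rewrite mxE mulmxnE mulrzDr -mulrzA -[Posz q]natz mulr_natl.
have Lz c : joined (z c) by apply: (subgroup_zcomb is_subgroup_joined).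
have zE (V : normedModType R) (h : {linear 'rV[R]_n -> V}) c :
    c \in copies T P -> `|h (z c)| <= M%:R * \sum_i `|h (row i B)|.
  move=> /hM cM; rewrite linear_sum; under eq_bigr do rewrite raddfMz.
  exact: ler_norm_zcomb.
have zr c : c \in copies T P -> `|rsubmx (z c)| < 2^-1.
  move=> /(zE _ rsubmx) /le_lt_trans; apply.
  apply: (@le_lt_trans _ _ (M%:R * \sum_(i < n) e)).
    by rewrite ler_wpM2l// ler_sum// => i _; exact/ltW/Be.
  rewrite sumr_const card_ord -[e *+ n]mulr_natr mulrCA mulrC -natrM /e invfM.
  rewrite mulrA mulrAC -[ltRHS]mul1r ltr_pM2r ?invr_gt0// ltr_pdivrMr//.
  by rewrite mul1r ltr_nat.
have h2 : 0 < 2^-1 :> R by rewrite invr_gt0.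
have [r1 r10 hr1] := model_set_relatively_dense h2.
have r0 : 0 < r by have [a _] := Ar 0; apply: le_lt_trans.
exists (r1 + M%:R * \sum_i `|lsubmx (row i B)| + r).
  by rewrite addr_gt0// ltr_wpDr// mulr_ge0// sumr_ge0.
move=> y; have [l0 Ll0 [l0y]] := hr1 y 0; rewrite subr0 => l0w.
pose x c := l0.1 + lsubmx (z c).
(* The colour f c of c is an element of D that moves x c into A. *)
have /choice[f fP] (c : 'rV[int]_n) : exists a, c \in copies T P ->
    [/\ a \in D, A (x c - a) & `|a| < r].
  have [cP|_] := boolP (c \in copies T P); last by exists 0.
  have [|a aD [Aa ar]] :=
      hD (x c) (l0.2 + rsubmx (z c)) (subgroupD sL Ll0 (Lz c)).
    by rewrite (le_lt_trans (ler_normD _ _))//; have := zr _ cP; lra.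
  by exists a.
have [[s q] pP [/= q0 mono]] := hP (fun c => inord (index (f c) D)).
have TP c : c \in T -> s + c *+ q \in copies T P.
  by move=> cT; apply: (allpairs_f (fun p a => p.1 + a *+ p.2)) pP cT.
have T0 : 0 \in T.
  apply/mapP; exists [ffun=> ord0]; first by rewrite mem_enum.
  by apply/rowP => j; rewrite !mxE ffunE.
set a := f (s + 0 *+ q).
have fa c : c \in T -> f (s + c *+ q) = a.
  move=> cT; have := congr1 (@nat_of_ord _) (mono c 0 cT T0).
  rewrite !inordK ?ltnS ?index_size// => fE.
  have [fD _ _] := fP _ (TP _ cT); have [aD _ _] := fP _ (TP _ T0).
  by rewrite -(nth_index 0 fD) fE nth_index.
pose st (i : 'I_n) : 'rV[R]_d := lsubmx (row i B) *~ q%:Z.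
exists (arith_prog N (x s - a) st).
  exists (x s - a), st; split=> // c cst j.
  have /eqP : q%:Z * c j = 0.
    apply: (zfree_lsubmx LB (zfree_unitmx Bu) (c := fun j => q%:Z * c j)).
    by rewrite -[RHS]cst; apply: eq_bigr => i _; rewrite mulrzA.
  by rewrite mulf_eq0 eqz_nat gtn_eqF//= => /eqP.
move=> _ [c cN ->].
pose c' : 'rV[int]_n := \row_j c j.
have cT : c' \in T.
  apply/mapP; exists [ffun j => inord `|c j|%N]; first by rewrite mem_enum.
  apply/rowP => j; rewrite !mxE ffunE; have /andP[c0 cN'] := cN j.
  by rewrite inordK ?gez0_abs// ltnS -lez_nat gez0_abs.
have -> : x s - a + \sum_j st j *~ c j = x (s + c' *+ q) - a.
  rewrite /x zD linearD [LHS]addrAC [in RHS]addrA; congr (_ + _ - _).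
  rewrite linear_sum /=; by apply: eq_bigr => i _; rewrite mxE !raddfMz.
have cTP := TP _ cT; have [_ Aa ar] := fP _ cTP; rewrite fa// in Aa ar.
split=> //=.
have -> : x (s + c' *+ q) - a - y =
    (l0.1 - y) + lsubmx (z (s + c' *+ q)) - a.
  by rewrite /x addrAC [_ + _ - y]addrAC.
rewrite (le_lt_trans (ler_normB _ _))// ler_ltD//.
by rewrite (le_trans (ler_normD _ _))// lerD ?(ltW l0y)// zE.
Qed.

End CutAndProject.

(** * Ranks of Meyer sets and model sets *)

Theorem theorem5p2 (R : realType) (d m : nat) (hd : (1 <= d)%N)
    (Lambda : set 'rV[R]_d) (L : set ('rV[R]_d * 'rV[R]_m))
    (W : set 'rV[R]_m) (F : set 'rV[R]_d) :
  meyer Lambda ->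
  is_cps L ->
  model_window W ->
  finite_set F ->
  Lambda `<=` [set x + f | x in cut_project L W & f in F] ->
  [/\ has_ap_rank Lambda (d + m),
      has_ap_rank (cut_project L W) (d + m),
      has_rank (cut_project L W) (d + m) &
      forall N : nat, exists2 r : R, 0 < r &
        forall y : 'rV[R]_d,
          contains_li_ap N (d + m) (Lambda `&` eball y r)].
Proof.
move=> [[r0 r00 denseLambda] _] [[isoL [sL compactL]] injL denseL].
move=> [cW intW] finF LWF.
have cocL := cocompact_relatively_dense compactL.
have [w Ww] : exists w : R, forall y, W y -> `|y| <= w.
  move: cW; rewrite precompactE => /compact_bounded/pinfty_ex_gt0[w _ Ww].
  by exists w => y Wy; apply: Ww; exact: subset_closure.
have apL := relatively_dense_contains_li_ap sL isoL cocL injL denseL Ww.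
have le := ap_rank_le sL isoL cocL injL denseL.
have apLambda := apL _ _ _ finF LWF.
have {}apLambda N : exists2 r : R, 0 < r & forall y : 'rV[R]_d,
    contains_li_ap N (d + m) (Lambda `&` eball y r).
  have [x|r r_gt0 hr] := apLambda r0 _ N.
    have [a [xa La]] := denseLambda x; exists a => //.
    by rewrite distrC; exact: eball_norm.
  exists (d%:R * r); first by rewrite mulr_gt0// ltr0n.
  move=> y; apply: contains_li_apS (hr y) => x [Lx /= xy]; split=> //.
  exact: norm_eball.
(* The model set is itself an instance, with F reduced to 0. *)
have WF0 : cut_project L W `<=`
    [set x + f | x in cut_project L W & f in [set 0]].
  by move=> x Wx; exists x => //; exists 0 => //; rewrite addr0.
split=> //.
- split=> [N|k]; last exact: le finF LWF.
  have [r _ /(_ 0)] := apLambda N; apply: contains_li_apS; exact: subIsetl.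
- split=> [N|k]; last exact: le (finite_set1 _) WF0.
  have [w0 /nbhs_ballP[e /= e0 eW]] := intW.
  have [r _ hr] := model_set_relatively_dense sL cocL denseL e0.
  have [x|r' _ /(_ 0)] := apL _ _ r (finite_set1 _) WF0 _ N; last first.
    by apply: contains_li_apS; exact: subIsetl.
  have [l Ll [lx lw]] := hr x w0; exists l.1; last by rewrite distrC.
  exists l.2; last by case: l Ll {lx lw}.
  by apply: eW; rewrite -ball_normE /= distrC.
- exact: has_rank_cut_project.
Qed.
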